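(* Let $\lambda>0$ and $\alpha\geq 0$ be given. Suppose $(Z_t^{\alpha})_{t\geq 0}$ is a timing process induced by the inter-renewal time $\exp(\lambda)$ and started at $\alpha$. Then for all $t\geq 0$, $$\mathbb{E}(Z_t^{\alpha})=\frac{1}{\lambda}(1-e^{-\lambda t})+\alpha e^{-\lambda t}$$ and $$\mathrm{Var}(Z_t^{\alpha})=\frac{1}{\lambda^2}\Bigl(1+e^{-t\lambda}\bigl(\alpha^2\lambda^2+2t\alpha\lambda^2-2\alpha\lambda-2t\lambda\bigr)+e^{-2t\lambda}\bigl(2\alpha\lambda-1-\alpha^2\lambda^2\bigr)\Bigr).$$
   Context: Timing process: let $(X_i)_{i\in\mathbb{N}}$ ($\mathbb{N}=\{1,2,\dots\}$, $\mathbb{N}_0=\mathbb{N}\cup\{0\}$) be a sequence of positive i.i.d. random variables on a probability space $(\Omega,\mathcal{F},\mathbb{P})$. Put $Y_n=\sum_{i=1}^n X_i$ for $n\in\mathbb{N}_0$ (so $Y_0=0$), and for $t\geq 0$ define $Z_t=\inf\{t-Y_n : n\in\mathbb{N}_0,\ t-Y_n\geq 0\}$. The process $(Z_t)_{t\geq 0}$ is called the timing process with renewal times $(Y_n)$ and inter-renewal times $(X_i)$, or the timing process induced by inter-renewal time $X$ (where $X$ has the common law of the $X_i$). ''Inter-renewal time $\exp(\lambda)$'' means that the $X_i$ are exponentially distributed with rate $\lambda$ (mean $1/\lambda$). Timing process started at $\alpha$: let $(Z_t)_{t\geq 0}$ be a timing process induced by inter-renewal time $X$. For $\alpha\geq 0$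 not an upper bound on the range of $X$ (so any $\alpha\ge 0$ in the exponential case), let $\tau_\alpha=\inf\{t\geq 0 : Z_t=\alpha\}$ be the first hitting time of $\alpha$ and define $Z_t^{\alpha}=Z_{\tau_\alpha+t}$ for $t\geq 0$. The process $(Z_t^{\alpha})_{t\geq 0}$ is called the timing process started at $\alpha$. (In the exponential case $\tau_\alpha<\infty$ almost surely, so the process is defined almost surely.) *)

(* Defs.v *)
(* MathComp / MathComp-Analysis *)
From HB Require Import structures.
From mathcomp Require Import all_boot all_order all_algebra.
From mathcomp Require Import all_classical all_reals all_analysis.

Set Implicit Arguments.
Unset Strict Implicit.
Unset Printing Implicit Defensive.

Import Order.TTheory GRing.Theory Num.Theory.
Import numFieldNormedType.Exports.

Local Open Scope classical_set_scope.
Local Open Scope ring_scope.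

(* A sequence X_1, X_2, ... is represented by X : nat -> _ with X i standing
   for X_{i+1}. *)

Section iid.
Context (d : measure_display) (T : measurableType d) (R : realType).
Variable P : probability T R.
Implicit Type X : nat -> {RV P >-> R}.

Definition mutually_independent X : Prop :=
  forall (s : seq nat) (B : nat -> set R),
    uniq s -> (forall i, measurable (B i)) ->
    P (\bigcap_(i in [set` s]) (X i @^-1` B i)) =
    (\prod_(i <- s) P (X i @^-1` B i))%E.

(* Laws are compared on Borel sets only: [distribution] and
   [exponential_prob] take arbitrary, meaningless values elsewhere. *)
Definition identically_distributed X : Prop :=
  forall (i j : nat) (B : set R), measurable B ->
    distribution P (X i) B = distribution P (X j) B.

Definition exponentially_distributed (lambda : R) (V : {RV P >-> R}) : Prop :=
  forall B : set R, measurable B ->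
    distribution P V B = exponential_prob lambda B.

Definition inter_renewal_times X : Prop :=
  [/\ {ae P, forall w, forall i, 0 < X i w},
      mutually_independent X & identically_distributed X].

End iid.

Section timing_process.
Context (T : Type) (R : realType).
Variable X : nat -> T -> R.

Definition renewal_time (n : nat) (w : T) : R := \sum_(i < n) X i w.

(* For t >= 0 the set contains t - Y_0 = t, hence is nonempty, and it is
   bounded below by 0. *)
Definition timing_process (t : R) (w : T) : R :=
  inf [set t - renewal_time n w | n in [set n | 0 <= t - renewal_time n w]].

(* +oo when alpha is never hit. *)
Definition hitting_time (alpha : R) (w : T) : \bar R :=
  ereal_inf (EFin @` [set t : R | 0 <= t /\ timing_process t w = alpha]).

(* The value is meaningful on the event hitting_time alpha < +oo only; outside
   of it the convention fine +oo = 0 applies. *)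
Definition timing_process_started_at (alpha t : R) (w : T) : R :=
  timing_process (fine (hitting_time alpha w) + t) w.

End timing_process.

(* Main.v *)
(* Let tau be the hitting time of alpha and Y_m the m-th renewal time.  The
   "countdown" D_m, which is alpha until an inter-renewal time exceeds alpha and
   tau - Y_m afterwards, satisfies D_(m+1) = D_m - X_m or alpha, according to
   whether D_m < X_m, so it is independent of X_m, X_(m+1), ...  Almost surely
   there is exactly one m with 0 <= D_m + t < X_m, and then Z_t^alpha = D_m + t.
   For s <= t there is no renewal in ]tau + s, tau + t] iff 0 <= D_m + s and
   D_m + t < X_m for some m; memorylessness compares the probability of this
   event with that for t = s and, summing over m,
   P(Z_t^alpha >= x) = exp(- lambda x) for 0 <= x <= t.
   Since Z_t^alpha >= t forces Z_t^alpha = alpha + t, this gives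
   Z_t^alpha = M + alpha 1_{M = t} with M = min(Z_t^alpha, t), and the moments
   of M follow by integrating its tail. *)
Require Import Defs.
From HB Require Import structures.
From mathcomp Require Import all_boot all_order all_algebra.
From mathcomp Require Import all_classical all_reals all_analysis.
From mathcomp Require Import measurable_realfun ring lra.

Set Implicit Arguments.
Unset Strict Implicit.
Unset Printing Implicit Defensive.

Import Order.TTheory GRing.Theory Num.Theory.
Import numFieldNormedType.Exports.

Local Open Scope classical_set_scope.
Local Open Scope ring_scope.

(** * Pathwise study of the countdown and of the hitting time *)

Section countdown.
Context (T : Type) (R : realType).
Variables (X : nat -> T -> R) (alpha : R).

(** Recursion on the inter-renewal times alone makes [countdown m] a function of the first [m] of
    them, so that the hitting time never enters the independence argument. *)
Fixpoint countdown (m : nat) (w : T) : R :=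
  if m is k.+1 then
    if countdown k w < X k w then countdown k w - X k w else alpha
  else alpha.

(** The unboundedness clause makes every level get hit and the renewal times tend to infinity;
    integer bounds keep the event a countable intersection. *)
Definition good_path (w : T) : Prop :=
  (forall i, 0 < X i w) /\ (forall k : nat, exists i, k%:R < X i w).

Local Notation Y := (renewal_time X).
Local Notation D := countdown.
Hypothesis alpha_ge0 : 0 <= alpha.

Lemma renewal_timeS n w : Y n.+1 w = Y n w + X n w.
Proof. by rewrite /renewal_time big_ord_recr. Qed.

Lemma renewal_time0 w : Y 0 w = 0.
Proof. by rewrite /renewal_time big_ord0. Qed.

Lemma timing_process_ge0 (u : R) w : 0 <= timing_process X u w.
Proof.
rewrite /timing_process; set S := [set _ | _ in _].
(* The set is empty only for negative [u], where [inf] takes its default value 0. *)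
have [->|/set0P S0] := eqVneq S set0; first by rewrite inf0.
by apply: lb_le_inf => // _ [n /= ? <-].
Qed.

Section good_path_theory.
Variable w : T.
Hypothesis w_good : good_path w.

Lemma good_path_gt (r : R) : exists i, r < X i w.
Proof.
have [i Xi] := w_good.2 (Num.truncn r).+1; exists i.
by apply: lt_trans Xi; exact: truncnS_gt.
Qed.

Lemma renewal_time_homo : {homo Y ^~ w : m n / (m <= n)%N >-> m <= n}.
Proof.
apply: homo_leq => //; first exact: le_trans.
by move=> n; rewrite renewal_timeS lerDl ltW// w_good.1.
Qed.

Lemma renewal_time_ge0 n : 0 <= Y n w.
Proof. by rewrite -(renewal_time0 w); exact: renewal_time_homo. Qed.

Lemma renewal_time_locate (u : R) : 0 <= u -> exists m, Y m w <= u < Y m.+1 w.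
Proof.
move=> u_ge0; have [i Xi] := good_path_gt u.
have ex : exists m, u < Y m w.
  exists i.+1; rewrite renewal_timeS (lt_le_trans Xi)// lerDr.
  exact: renewal_time_ge0.
case: (ex_minnP ex) => -[|m] um min_m.
  by move: um; rewrite renewal_time0 ltNge u_ge0.
by exists m; rewrite um andbT leNgt; apply/negP => /min_m; rewrite ltnn.
Qed.

Lemma timing_processE (m : nat) (u : R) :
  Y m w <= u -> u < Y m.+1 w -> timing_process X u w = u - Y m w.
Proof.
move=> mu um; rewrite /timing_process; set S := [set _ | _ in _].
have lbS : lbound S (u - Y m w).
  move=> _ [n /= nu <-]; rewrite lerB//; apply: renewal_time_homo.
  rewrite leqNgt; apply/negP => mn; move: nu; rewrite subr_ge0 leNgt.
  by rewrite (lt_le_trans um)// renewal_time_homo.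
have Sm : S (u - Y m w) by exists m => //=; rewrite subr_ge0.
apply/eqP; rewrite eq_le; apply/andP; split.
  by apply: ge_inf => //; exists (u - Y m w).
by apply: lb_le_inf => //; exists (u - Y m w).
Qed.

(** A reset gives [alpha], and a subtraction is made only when its result is negative. *)
Lemma countdown_alpha_or_neg m : D m w = alpha \/ D m w < 0.
Proof.
case: m => [|m] /=; first by left.
by case: (ltP (D m w) (X m w)) => [|_]; [rewrite -subr_lt0; right|left].
Qed.

Lemma countdown_le m : D m w <= alpha.
Proof. by case: (countdown_alpha_or_neg m) => [->//|/ltW/le_trans ->]. Qed.

(** Below [- t <= 0] the countdown is smaller than the positive [X _ w], so it is never reset and
    keeps decreasing. *)
Lemma countdown_ltN (t : R) (m j : nat) : 0 <= t ->
  D m w < - t -> D (m + j) w < - t.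
Proof.
move=> t_ge0 Dm; elim: j => [|j IH]; rewrite ?addn0 ?addnS//=.
have X_gt0 := w_good.1 (m + j)%N.
by case: (ltP (D _ w) (X _ w)) => ?; lra.
Qed.

Lemma countdown_step (t : R) (m : nat) : 0 <= t ->
  D m w + t < X m w -> D m.+1 w < - t.
Proof. by move=> t_ge0 /= DX; case: (ltP (D _ w) (X _ w)) => ?; lra. Qed.

(** The smaller of two distinct indices would send the countdown below [- t] for good from the next
    step on, against the condition at the larger one. *)
Lemma countdown_uniq (t : R) (m n : nat) : 0 <= t ->
  0 <= D m w + t -> D m w + t < X m w ->
  0 <= D n w + t -> D n w + t < X n w -> m = n.
Proof.
move=> t_ge0 m0 mX n0 nX.
have aux p q : (p < q)%N -> D p w + t < X p w -> 0 <= D q w + t -> False.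
  move=> pq pX.
  have := countdown_ltN (q - p.+1) t_ge0 (countdown_step t_ge0 pX).
  by rewrite subnKC//; lra.
by case: (ltngtP m n) => // /aux; [move/(_ mX n0)|move/(_ nX m0)].
Qed.

(** The wanted index precedes the first one at which the countdown is below [- t]; that one is not
    0, because the countdown starts at [alpha >= 0]. *)
Lemma countdown_exists (t : R) : 0 <= t ->
  exists m, 0 <= D m w + t /\ D m w + t < X m w.
Proof.
move=> t_ge0; have ex : exists m, D m w < - t.
  apply: contrapT => /forallNP noD; have [i Xi] := good_path_gt (alpha + t).
  apply: (noD i.+1); apply: countdown_step => //.
  by rewrite (le_lt_trans _ Xi)// lerD2r countdown_le.
case: (ex_minnP ex) => -[|m] /= Dm min_m.
  by suff : alpha < 0; [rewrite ltNge alpha_ge0|lra].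
exists m; have : - t <= D m w.
  by rewrite leNgt; apply/negP => /min_m; rewrite ltnn.
move=> tD; case: (ltP (D m w) (X m w)) Dm => _ Dm; first by split; lra.
by suff : alpha < 0; [rewrite ltNge alpha_ge0|lra].
Qed.

(** Let [N] be the first index with [alpha < X N w]. No earlier gap is long enough for the age
    [alpha], so the hitting time is [Y N w + alpha]; from [N] on, the countdown is this time minus
    the renewal time, and adding [t] gives the age. *)
Lemma started_atE (t : R) (m : nat) : 0 <= t ->
  0 <= D m w + t -> D m w + t < X m w ->
  timing_process_started_at X alpha t w = D m w + t.
Proof.
move=> t_ge0 m0 mX.
case: (ex_minnP (good_path_gt alpha)) => N XN min_N.
have Dle n : (n <= N)%N -> D n w = alpha.
  elim: n => // n IH nN /=; rewrite IH ?(ltnW nN)//.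
  by case: ifPn => // /min_N; rewrite leqNgt nN.
(* No reset occurs from [N] on: [Y N w + alpha < Y N.+1 w], and later renewal times are larger
   still. *)
have Dge j : D (N + j) w = Y N w + alpha - Y (N + j) w.
  elim: j => [|j IH]; first by rewrite addn0 Dle// addrAC subrr add0r.
  rewrite addnS renewal_timeS /= IH ifT; first by rewrite opprD addrA.
  rewrite ltrBlDr [ltRHS]addrC -renewal_timeS.
  apply: (@lt_le_trans _ _ (Y N.+1 w)); first by rewrite renewal_timeS ltrD2l.
  by apply: renewal_time_homo; rewrite ltnS leq_addr.
have Nm : (N <= m)%N.
  apply/negPn; rewrite -ltnNge; apply/negP => mN.
  move: mX; rewrite Dle ?(ltnW mN)// => amX.
  have /min_N : alpha < X m w by lra.
  by rewrite leqNgt mN.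
have hit : hitting_time X alpha w = (Y N w + alpha)%:E.
  apply/eqP; rewrite eq_le; apply/andP; split.
    apply: ereal_inf_lbound; exists (Y N w + alpha) => //=; split.
      by rewrite addr_ge0// renewal_time_ge0.
    rewrite (@timing_processE N) ?lerDl//.
      by rewrite addrC addrA addNr add0r.
    by rewrite renewal_timeS ltrD2l.
  (* An age [alpha] reached in the [n]-th gap makes this gap longer than [alpha], hence [N <= n]. *)
  apply: le_ereal_inf_tmp => _ [u [u_ge0 Zu] <-]; rewrite lee_fin.
  have [n /andP[nu un]] := renewal_time_locate u_ge0.
  move: Zu; rewrite (timing_processE nu un) => Zu.
  have Nn : (N <= n)%N by apply: min_N; move: un; rewrite renewal_timeS; lra.
  by have := renewal_time_homo Nn; lra.
move: m0 mX; rewrite -(subnKC Nm); set k := (N + _)%N; rewrite Dge -/k => m0 mX.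
rewrite /timing_process_started_at hit /= (@timing_processE k).
- by lra.
- by lra.
- by rewrite renewal_timeS; lra.
Qed.

End good_path_theory.
End countdown.

(** * Integrals over conull sets, integrability of bounded variables *)

Section measure_lemmas.
Local Open Scope ereal_scope.
Context d (T : measurableType d) (R : realType).

Import HBNNSimple.

(* f need not be measurable: both sides are suprema over simple functions. *)
Lemma ge0_integral_conull (mu : {measure set T -> \bar R}) (G : set T)
    (f : T -> \bar R) : measurable G -> mu (~` G) = 0 -> (forall x, 0 <= f x) ->
  \int[mu]_x f x = \int[mu]_(x in G) f x.
Proof.
move=> mG G0 f0; apply/eqP; rewrite eq_le; apply/andP; split.
  rewrite ge0_integralTE// ge0_integralE//.
  apply: ge_ereal_sup => _ [h /= hf <-]; apply: le_ereal_sup_tmp.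
  exists (sintegral mu (proj_nnsfun h mG)).
    exists (proj_nnsfun h mG) => // x; rewrite -mrestrict /= !patchE.
    by case: ifPn.
  rewrite -mrestrict -integral_nnsfun// -integralT_nnsfun.
  rewrite (@ge0_negligible_integral _ _ _ mu setT (~` G))//.
  - by rewrite setTD setCK.
  - exact: measurableC.
  - by apply/measurable_EFinP.
  - by move=> x _; rewrite lee_fin.
rewrite [leLHS]ge0_integralE// ge0_integralTE//.
apply: ge_ereal_sup => _ [h /= hf <-]; apply: le_ereal_sup_tmp.
exists (sintegral mu h) => //; exists h => // x.
by apply: le_trans (hf x) _; rewrite patchE; case: ifPn.
Qed.

(** Serves to replace the process, known to be measurable on the good event, by a genuine random
    variable. *)
Lemma expectation_eq_conull (P : probability T R) (G : set T) (f g : T -> R) :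
  measurable G -> P G = 1 -> (forall x, 0 <= f x)%R -> (forall x, 0 <= g x)%R ->
  {in G, f =1 g} -> 'E_P[f] = 'E_P[g].
Proof.
move=> mG G1 f0 g0 fg; have G0 : P (~` G) = 0.
  by rewrite probability_setC// G1 subee.
rewrite unlock (ge0_integral_conull mG G0); last first.
  by move=> x; rewrite lee_fin.
rewrite [RHS](ge0_integral_conull mG G0); last by move=> x; rewrite lee_fin.
by apply: eq_integral => x xG; rewrite fg.
Qed.

Lemma bounded_Lfun1 (P : probability T R) (f : T -> R) (b : R) :
  measurable_fun setT f -> (forall w, `|f w| <= b)%R -> f \in Lfun P 1.
Proof.
move=> mf fb; apply/Lfun1_integrable.
apply: measurable_bounded_integrable => //.
  by apply: le_lt_trans (probability_le1 P measurableT) _; exact: ltry.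
exists b; split; first exact: num_real.
by move=> y yb w _; exact: le_trans (fb w) (ltW yb).
Qed.

Lemma measurable_le_set (f g : T -> R) : measurable_fun setT f ->
  measurable_fun setT g -> measurable [set w | f w <= g w]%R.
Proof.
move=> mf mg; rewrite -[X in measurable X]setTI.
exact: (measurable_fun_ler mf mg measurableT (Y := [set true])).
Qed.

Lemma measurable_lt_set (f g : T -> R) : measurable_fun setT f ->
  measurable_fun setT g -> measurable [set w | f w < g w]%R.
Proof.
move=> mf mg; rewrite -[X in measurable X]setTI.
exact: (measurable_fun_ltr mf mg measurableT (Y := [set true])).
Qed.

End measure_lemmas.

(** * From rectangles to all measurable sets of a product *)

Section independence_extension.
Local Open Scope ereal_scope.
Context d d1 d2 (T : measurableType d) (T1 : measurableType d1)
  (T2 : measurableType d2) (R : realType) (P : probability T R).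

(** Rectangles form a generating class stable under intersection; the whole space is one of them, so
    a constant sequence serves as exhaustion. *)
Lemma finite_measure_prod_unique (m1 m2 : {measure set (T1 * T2) -> \bar R}) :
  m1 setT < +oo ->
  (forall A B, measurable A -> measurable B -> m1 (A `*` B) = m2 (A `*` B)) ->
  forall S, measurable S -> m1 S = m2 S.
Proof.
move=> m1fin m12 S mS.
pose C : set (set (T1 * T2)) :=
  [set A `*` B | A in measurable & B in measurable].
apply: (measure_unique C (fun=> setT)) => //.
- by rewrite measurable_prod_measurableType.
- move=> _ _ [A1 mA1 [B1 mB1 <-]] [A2 mA2 [B2 mB2 <-]].
  rewrite -setXI; exists (A1 `&` A2); first exact: measurableI.
  by exists (B1 `&` B2) => //; exact: measurableI.
- by move=> _; exists setT => //; exists setT => //; rewrite setXTT.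
- by rewrite bigcup_const.
- by move=> _ [A mA [B mB <-]]; exact: m12.
Qed.

(** For fixed [C], both sides are finite measures in [S]: the image under [W] of [P] restricted to
    [C], and the law of [W] scaled by [P C]. *)
Lemma indep_pair_ext (W : {RV P >-> (T1 * T2)%type}) (C : set T) :
  measurable C ->
  (forall A B, measurable A -> measurable B ->
     P (W @^-1` (A `*` B) `&` C) = P (W @^-1` (A `*` B)) * P C) ->
  forall S, measurable S -> P (W @^-1` S `&` C) = P (W @^-1` S) * P C.
Proof.
move=> mC WC S mS.
have mW : measurable_fun setT W by exact: measurable_funPT.
have PC0 : (0 <= fine (P C))%R by exact: fine_ge0.
have PCE : P C = (NngNum PC0)%:num%:E by rewrite /= fineK// fin_num_measure.
pose m1 : {measure set (T1 * T2) -> \bar R} :=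
  pushforward (mrestr P mC) (W : T -> T1 * T2).
pose m2 : {measure set (T1 * T2) -> \bar R} :=
  mscale (NngNum PC0) (distribution P W).
rewrite muleC PCE.
apply: (@finite_measure_prod_unique (m1 mW) m2) => //.
  rewrite /= /pushforward /mrestr preimage_setT setTI.
  by rewrite (le_lt_trans (probability_le1 P mC))// ltry.
move=> A B mA mB; rewrite /= /pushforward /mrestr /mscale -PCE muleC.
exact: WC.
Qed.
End independence_extension.

(** * Independence of the countdown from the future; exponential tails *)

Section countdown_probability.
Context d (T : measurableType d) (R : realType) (P : probability T R).
Variables (X : nat -> {RV P >-> R}) (alpha : R).

Local Notation D := (countdown X alpha).

Definition countdown_step_fun (p : R * R) : R :=
  if p.1 < p.2 then p.1 - p.2 else alpha.

Lemma measurable_countdown_step_fun : measurable_fun setT countdown_step_fun.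
Proof.
apply: measurable_fun_ifT => //; first exact: measurable_fun_ltr.
exact: measurable_funB.
Qed.

Lemma measurable_countdown m : measurable_fun setT (D m).
Proof.
elim: m => //= m IH.
rewrite (_ : (fun w => _) = countdown_step_fun \o (fun w => (D m w, X m w)))//.
apply: measurableT_comp; first exact: measurable_countdown_step_fun.
exact: measurable_fun_pair.
Qed.

HB.instance Definition _ m :=
  isMeasurableFun.Build _ _ _ _ (D m) (measurable_countdown m).

Definition countdown_pair m (w : T) : R * R := (D m w, X m w).

Lemma measurable_countdown_pair m : measurable_fun setT (countdown_pair m).
Proof. exact: measurable_fun_pair. Qed.

HB.instance Definition _ m :=
  isMeasurableFun.Build _ _ _ _ (countdown_pair m)
    (measurable_countdown_pair m).

Hypothesis X_indep : mutually_independent X.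

(** A whole finite family of indices at least [m] is carried along for the induction: on rectangles,
    the event on [X m] joins this family and the induction hypothesis applies to [m :: s]. *)
Lemma countdown_indep m (s : seq nat) (A : set R) (B : nat -> set R) :
  uniq s -> (forall i, i \in s -> (m <= i)%N) -> measurable A ->
  (forall i, measurable (B i)) ->
  let C := \bigcap_(i in [set` s]) (X i @^-1` B i) in
  P (D m @^-1` A `&` C) = (P (D m @^-1` A) * P C)%E.
Proof.
elim: m s A B => [|m IH] s A B s_uniq ms mA mB C.
  rewrite (_ : D 0 @^-1` A = if alpha \in A then setT else set0); last first.
    by rewrite -preimage_cst.
  case: ifPn => _; first by rewrite setTI probability_setT mul1e.
  by rewrite set0I measure0 mul0e.
have sE i : i \in s -> i != m by move=> /ms; case: ltngtP.
have mC : measurable C.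
  by apply: bigcap_measurableType => i _; exact: measurable_funPTI.
rewrite (_ : D m.+1 @^-1` A =
  countdown_pair m @^-1` (countdown_step_fun @^-1` A))//.
apply: (@indep_pair_ext _ _ _ _ _ _ _ P (countdown_pair m)) => //; last first.
  by rewrite -[X in measurable X]setTI; exact: measurable_countdown_step_fun.
move=> A' B' mA' mB'.
have pairE : countdown_pair m @^-1` (A' `*` B') = D m @^-1` A' `&` X m @^-1` B'.
  by [].
have -> : P (countdown_pair m @^-1` (A' `*` B')) =
    (P (D m @^-1` A') * P (X m @^-1` B'))%E.
  have := IH [:: m] A' (fun=> B') isT _ mA' (fun=> mB').
  rewrite /= set_cons1 bigcap_set1 pairE; apply.
  by move=> i; rewrite inE => /eqP ->.
pose B'' i := if i == m then B' else B i.
have mB'' i : measurable (B'' i) by rewrite /B''; case: ifP.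
have CE : X m @^-1` B' `&` C = \bigcap_(i in [set` m :: s]) (X i @^-1` B'' i).
  rewrite /C !bigcap_seq big_cons {1}/B'' eqxx; congr (_ `&` _).
  by apply: eq_big_seq => i /sE; rewrite /B'' => /negbTE ->.
have ms_uniq : uniq (m :: s).
  by rewrite /= s_uniq andbT; apply/negP => /sE; rewrite eqxx.
rewrite pairE -setIA CE IH//; last first.
  by move=> i; rewrite inE => /predU1P[->//|/ms/ltnW].
rewrite X_indep// big_cons {1}/B'' eqxx muleA; congr (_ * _)%E.
rewrite X_indep//; apply: eq_big_seq => i /sE.
by rewrite /B'' => /negbTE ->.
Qed.

Lemma countdown_indep1 m (A B : set R) : measurable A -> measurable B ->
  P (D m @^-1` A `&` X m @^-1` B) = (P (D m @^-1` A) * P (X m @^-1` B))%E.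
Proof.
move=> mA mB; have := @countdown_indep m [:: m] A (fun=> B) isT _ mA (fun=> mB).
rewrite /= set_cons1 bigcap_set1; apply.
by move=> i; rewrite inE => /eqP ->.
Qed.

Variable lambda : R.
Hypothesis lambda_gt0 : 0 < lambda.
Hypothesis X_exp : forall i, exponentially_distributed lambda (X i).

Lemma exponential_prob_tail (y : R) : 0 <= y ->
  exponential_prob lambda `]y, +oo[%classic = (expR (- (lambda * y)))%:E.
Proof.
move=> y_ge0; rewrite /exponential_prob integral_itv_obnd_cbnd; last first.
  apply: measurable_funTS; apply/measurable_EFinP.
  exact: measurable_exponential_pdf.
have cE : continuous (fun z : R^o => expR (- lambda * z)).
  move=> z; apply: continuous_comp; last exact: continuous_expR.
  by apply: continuousM => //; exact: cst_continuous.
rewrite (@ge0_continuous_FTC2y _ _ (fun x => - expR (- lambda * x)) _ 0).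
- by rewrite sub0e -EFinN opprK mulNr.
- by move=> x _; apply: exponential_pdf_ge0; exact: ltW.
- apply: (@continuous_subspaceW R^o _ _ [set` `[0, +oo[%R]).
    by apply: subset_itvr; rewrite bnd_simp.
  exact: within_continuous_exponential_pdf.
- rewrite -oppr0; apply: cvgN.
  rewrite (_ : (fun x => expR (- lambda * x)) =
               (fun z => expR (- z)) \o (fun z => lambda * z)); last first.
    by apply: eq_fun => x; rewrite mulNr.
  apply: (@cvg_comp _ _ _ _ _ _ (pinfty_nbhs R)); last exact: cvgr_expR.
  exact: gt0_cvgMry.
- by move=> x _; exact: ex_derive.
- by apply: cvgN; apply/cvg_at_right_filter; exact: cE.
- move=> x; rewrite in_itv/= andbT => yx.
  by apply: derive1_exponential_pdf; rewrite in_itv/= andbT (le_lt_trans _ yx).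
Qed.

Lemma interarrival_tail i (y : R) : 0 <= y ->
  P [set w | y < X i w] = (expR (- (lambda * y)))%:E.
Proof.
move=> y_ge0; rewrite -exponential_prob_tail// -(X_exp i)//.
by congr (P _); apply/seteqP; split => w /=; rewrite in_itv/= andbT.
Qed.

End countdown_probability.

(** * The good event and the tail of the started process *)

Section renewal_events.
Context d (T : measurableType d) (R : realType) (P : probability T R).
Variables (X : nat -> {RV P >-> R}) (alpha lambda : R).
Hypothesis lambda_gt0 : 0 < lambda.
Hypothesis alpha_ge0 : 0 <= alpha.
Hypothesis X_renewal : inter_renewal_times X.
Hypothesis X_exp : forall i, exponentially_distributed lambda (X i).

Local Notation D := (countdown X alpha).

Definition silent_set (s t : R) : set (R * R) :=
  [set p | 0 <= p.1 + s /\ p.1 + t < p.2].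

(** On a good path with [0 <= s <= t], the [m]-th renewal is the last one up to [s] after the
    hitting time, and the next one comes later than [t] after it. *)
Definition silent_event (m : nat) (s t : R) : set T :=
  [set w | 0 <= D m w + s /\ D m w + t < X m w].

Lemma measurable_silent_set s t : measurable (silent_set s t).
Proof.
rewrite (_ : silent_set s t =
  [set p | 0 <= p.1 + s] `&` [set p | p.1 + t < p.2])//.
apply: measurableI; [apply: measurable_le_set|apply: measurable_lt_set] => //.
  exact: measurable_funD.
exact: measurable_funD.
Qed.

Lemma measurable_silent_event m s t : measurable (silent_event m s t).
Proof.
rewrite (_ : silent_event m s t =
  countdown_pair X alpha m @^-1` silent_set s t)//.
rewrite -[X in measurable X]setTI.
exact: measurable_countdown_pair (measurable_silent_set s t).
Qed.

(** Independence makes the law of the pair the product of the two laws, whose value on a set is the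
    integral over its sections. *)
Lemma silent_event_probE m s t :
  P (silent_event m s t) =
  (\int[distribution P (D m)]_u
     distribution P (X m) (xsection (silent_set s t) u))%E.
Proof.
symmetry; apply: (@product_measure_unique _ _ _ _ _
  (distribution P (D m)) (distribution P (X m))
  (distribution P (countdown_pair X alpha m))).
  move=> A B mA mB; case: X_renewal => _ X_indep _.
  exact: (countdown_indep1 alpha X_indep m mA mB).
exact: measurable_silent_set.
Qed.

(* Memorylessness of the exponential law, applied at the random level
   [D m + s], which is independent of [X m]. *)
Lemma silent_event_shift m s t : s <= t ->
  P (silent_event m s t) =
  ((expR (- (lambda * (t - s))))%:E * P (silent_event m s s))%E.
Proof.
move=> st; rewrite !silent_event_probE -ge0_integralZl//=; last first.
  apply: (measurable_fun_xsection (distribution P (X m))).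
  exact: measurable_silent_set.
apply: eq_integral => u _.
(* The section is the half-line above [u + r] if [0 <= u + s] and empty otherwise; [s <= r] makes
   [u + r] nonnegative, as the tail formula requires. *)
have sectionE r : s <= r -> distribution P (X m) (xsection (silent_set s r) u) =
    if 0 <= u + s then (expR (- (lambda * (u + r))))%:E else 0%E.
  move=> sr; case: ifPn => [us|us].
    rewrite -(interarrival_tail lambda_gt0 X_exp m); last by lra.
    congr (P _); apply/seteqP.
    split => w /=; rewrite /xsection/= inE /silent_set/=.
      by case.
    by [].
  rewrite (_ : xsection _ _ = set0) ?measure0// -subset0 => v.
  by rewrite /xsection/= inE /silent_set/= (negbTE us) => -[].
rewrite !sectionE//; case: ifPn => _; last by rewrite mule0.
by rewrite -EFinM -expRD; congr (expR _)%:E; lra.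
Qed.

Definition good_event : set T := [set w | good_path X w].

Lemma measurable_good_event : measurable good_event.
Proof.
rewrite (_ : good_event = (\bigcap_i (X i @^-1` `]0, +oo[)) `&`
    (\bigcap_k \bigcup_i (X i @^-1` `]k%:R, +oo[))); last first.
  apply/seteqP; split => w /= [w_gt0 w_unb].
    split; first by move=> i _; rewrite /= in_itv/= andbT.
    move=> k _; have [i ki] := w_unb k; exists i => //=.
    by rewrite in_itv/= andbT.
  split; first by move=> i; have := w_gt0 i I; rewrite /= in_itv/= andbT.
  by move=> k; have [i _] := w_unb k I; rewrite /= in_itv/= andbT; exists i.
apply: measurableI.
  by apply: bigcapT_measurable => i; exact: measurable_funPTI.
apply: bigcapT_measurable => k; apply: bigcupT_measurable => i.
exact: measurable_funPTI.
Qed.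

(** The first [n] inter-renewal times are all at most [r] with probability [q ^+ n], and [q < 1]
    because the exponential tail is positive. *)
Lemma bounded_interarrivals_null (r : R) : 0 <= r ->
  P (\bigcap_i (X i @^-1` `]-oo, r])) = 0%E.
Proof.
move=> r_ge0; set A := \bigcap_i _.
have mA : measurable A.
  by apply: bigcapT_measurable => i; exact: measurable_funPTI.
pose q := 1 - expR (- (lambda * r)).
have Pq i : P (X i @^-1` `]-oo, r]) = q%:E.
  rewrite EFinB -(interarrival_tail lambda_gt0 X_exp i r_ge0).
  rewrite -probability_setC//; last exact: measurable_lt_set.
  congr (P _); apply/seteqP; split => w /=; rewrite in_itv/= leNgt.
    exact/negP.
  by move/negP.
have q_ge0 : 0 <= q by rewrite subr_ge0 -expR0 ler_expR oppr_le0 mulr_ge0// ltW.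
have q_lt1 : q < 1 by rewrite /q ltrBlDr ltrDl expR_gt0.
have PAq n : (P A <= (q ^+ n)%:E)%E.
  have [_ + _] := X_renewal.
  move=> /(_ (index_iota 0 n) (fun=> `]-oo, r]%classic) (iota_uniq _ _)).
  move=> /(_ (fun=> measurable_itv _)).
  under [in RHS]eq_bigr do rewrite Pq.
  rewrite prodEFin prodr_const_nat subn0 => <-.
  apply: le_measure; rewrite ?inE//.
    by apply: bigcap_measurableType => i _; exact: measurable_funPTI.
  by move=> w Aw i _; exact: Aw.
have q_cvg : q ^+ n @[n --> \oo] --> 0 by apply: cvg_expr; rewrite ger0_norm.
have PAfin : P A \is a fin_num by rewrite fin_num_measure.
have : fine (P A) <= 0.
  rewrite -(cvg_lim _ q_cvg)//; apply: limr_ge.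
    by apply/cvg_ex; exists 0.
  by near=> n; rewrite -lee_fin fineK.
rewrite -lee_fin fineK// => PA_le0.
by apply/eqP; rewrite eq_le PA_le0 measure_ge0.
Unshelve. all: by end_near. Qed.

(** Countably many null events are discarded, one for each natural bound on the inter-renewal times,
    besides the failure of positivity. *)
Lemma good_event_prob1 : P good_event = 1%E.
Proof.
have mG := measurable_good_event.
suff G0 : P (~` good_event) = 0%E.
  by have := probability_setC P (measurableC mG); rewrite setCK G0 sube0.
apply: measure_negligible; first exact: measurableC.
have [X_gt0 _ _] := X_renewal.
have : {ae P, forall w, forall k : nat, exists i, k%:R < X i w}.
  apply: ae_foralln => k.
  exists (\bigcap_i (X i @^-1` `]-oo, k%:R])); split.
  - by apply: bigcapT_measurable => i; exact: measurable_funPTI.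
  - exact: bounded_interarrivals_null.
  - move=> w /= /forallNP noi i _ /=; rewrite in_itv/= leNgt.
    by apply/negP; exact: noi.
move=> X_unb; have : {ae P, forall w, good_path X w}.
  by apply: filterS2 X_gt0 X_unb => w; split.
by [].
Qed.

Lemma prob_good_eventI (A : set T) : measurable A -> P (good_event `&` A) = P A.
Proof.
move=> mA; have mG := measurable_good_event.
have G0 : P (~` good_event) = 0%E.
  by rewrite probability_setC// good_event_prob1 subee.
rewrite [RHS](measureDI P mA mG) setIC -[LHS]add0e; congr (_ + _)%E.
apply/esym; apply: (@subset_measure0 _ _ _ P _ (~` good_event)) => //.
- exact: measurableD.
- exact: measurableC.
Qed.

Section law.
Variables (t : R).
Hypothesis t_ge0 : 0 <= t.

Local Notation Z := (timing_process_started_at X alpha t).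

Lemma measurable_started_at : measurable_fun good_event Z.
Proof.
have GE : good_event = \bigcup_m (good_event `&` silent_event m t t).
  rewrite -setI_bigcupr setIidl// => w w_good.
  have [m [m0 mX]] := countdown_exists alpha_ge0 w_good t_ge0.
  by exists m.
rewrite GE; apply/measurable_fun_bigcup => m.
  apply: measurableI; first exact: measurable_good_event.
  exact: measurable_silent_event.
apply: (eq_measurable_fun (fun w => D m w + t)).
  move=> w; rewrite inE => -[w_good [m0 mX]].
  by rewrite (started_atE alpha_ge0 w_good t_ge0 m0 mX).
by apply: measurable_funTS; apply: measurable_funD.
Qed.

(* For every [s <= t], the good event is partitioned by the index of the last
   renewal before time [s] (counted from the hitting time of [alpha]). *)
Lemma prob_started_at_ge (x : R) : 0 <= x <= t ->
  P (good_event `&` [set w | x <= Z w]) = (expR (- (lambda * x)))%:E.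
Proof.
move=> /andP[x_ge0 xt]; pose s := t - x.
have s_ge0 : 0 <= s by rewrite subr_ge0.
have st : s <= t by rewrite gerBl.
have prob_bigcup r : s <= r ->
    P (\bigcup_m (good_event `&` silent_event m s r)) =
    (\sum_(m <oo) P (silent_event m s r))%E.
  move=> sr; rewrite measure_bigcup//=; last 2 first.
  - move=> m _; apply: measurableI; first exact: measurable_good_event.
    exact: measurable_silent_event.
  - apply/trivIsetP => m n _ _ mn; rewrite -subset0.
    move=> w [[w_good [m0 mX]] [_ [n0 nX]]].
    move/eqP : mn; apply.
    by apply: (countdown_uniq w_good s_ge0) => //; lra.
  rewrite (eq_eseriesl _ _ (fun m => in_setT m)).
  apply: eq_eseriesr => m _; apply: prob_good_eventI.
  exact: measurable_silent_event.
have GE : good_event = \bigcup_m (good_event `&` silent_event m s s).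
  rewrite -setI_bigcupr setIidl// => w w_good.
  have [m [m0 mX]] := countdown_exists alpha_ge0 w_good s_ge0.
  by exists m.
(* As [s = t - x], the condition [x <= D m w + t] reads [0 <= D m w + s]: an age of at least [x] at
   time [t] means silence since [s]. *)
have ZE : good_event `&` [set w | x <= Z w] =
    \bigcup_m (good_event `&` silent_event m s t).
  apply/seteqP; split => [w [w_good /= xZ]|w [m _ [w_good [m0 mX]]]].
    have [m [m0 mX]] := countdown_exists alpha_ge0 w_good t_ge0.
    exists m => //; split => //; split => //.
    by move: xZ; rewrite (started_atE alpha_ge0 w_good t_ge0 m0 mX) /s; lra.
  split => //=; rewrite (started_atE alpha_ge0 w_good t_ge0 _ mX); last first.
    by rewrite (le_trans m0)// lerD2l.
  by move: m0; rewrite /s; lra.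
rewrite ZE prob_bigcup//.
(* The factor is the same for every [m], and the remaining sum is the probability of the good
   event. *)
under eq_eseriesr do rewrite silent_event_shift//.
rewrite nneseriesZl// -prob_bigcup// -GE good_event_prob1 mule1.
by congr (expR _)%:E; rewrite /s; lra.
Qed.

Lemma started_at_bounds w : good_path X w -> 0 <= Z w <= alpha + t.
Proof.
move=> w_good; have [m [m0 mX]] := countdown_exists alpha_ge0 w_good t_ge0.
rewrite (started_atE alpha_ge0 w_good t_ge0 m0 mX) m0 lerD2r.
exact: countdown_le.
Qed.

(** [t <= D m w + t] makes the countdown nonnegative, and [alpha] is its only possible nonnegative
    value. *)
Lemma started_at_ge w : good_path X w -> t <= Z w -> Z w = alpha + t.
Proof.
move=> w_good; have [m [m0 mX]] := countdown_exists alpha_ge0 w_good t_ge0.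
rewrite (started_atE alpha_ge0 w_good t_ge0 m0 mX) lerDr.
case: (countdown_alpha_or_neg X alpha w m) => [->//|].
by rewrite ltNge => /negbTE ->.
Qed.

End law.

End renewal_events.

(** * Elementary integrals over compact intervals *)

Section integrals.
Local Open Scope ereal_scope.
Context (R : realType).
Let mu : {measure set (measurableTypeR R) -> \bar R} := @lebesgue_measure R.

Lemma integral_FTC2_is_derive (f F : R -> R) (a b : R) : (a <= b)%R ->
  continuous f -> (forall x : R, is_derive x 1%R F (f x)) ->
  \int[mu]_(x in `[a, b]) (f x)%:E = (F b - F a)%:E.
Proof.
move=> ab cf dF.
have cF : continuous F.
  move=> x; apply: differentiable_continuous.
  by apply/derivable1_diffP; exact: ex_derive.
move: ab; rewrite le_eqVlt => /predU1P[->|ab].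
  by rewrite set_itv1 integral_set1 subrr.
rewrite EFinB; apply: continuous_FTC2 => //.
- exact: continuous_subspaceT.
- split.
  + by move=> x _; exact: ex_derive.
  + exact/cvg_at_right_filter/cF.
  + exact/cvg_at_left_filter/cF.
- by move=> x _; rewrite derive1E; exact: derive_val.
Qed.

Lemma integral_expR (lambda t : R) : lambda != 0%R -> (0 <= t)%R ->
  \int[mu]_(r in `[0%R, t]) (expR (- (lambda * r)))%:E =
  (lambda^-1 * (1 - expR (- (lambda * t))))%:E.
Proof.
move=> l0 t0.
have cexp : continuous (fun r : R => expR (- (lambda * r))).
  move=> x; apply: continuous_comp; last exact: continuous_expR.
  apply: (@continuousN _ R^o); apply: continuousM => //; exact: cst_continuous.
have dF (x : R) :
    is_derive x 1%R (fun r => - lambda^-1 * expR (- (lambda * r)))%R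
      (expR (- (lambda * x))).
  by apply: is_derive_eq; rewrite /GRing.scale/=; field.
rewrite (integral_FTC2_is_derive t0 cexp dF).
by rewrite mulr0 oppr0 expR0; congr _%:E; ring.
Qed.

Lemma integral_mulr_expR (lambda t : R) : lambda != 0%R -> (0 <= t)%R ->
  \int[mu]_(r in `[0%R, t]) (2 * r * expR (- (lambda * r)))%:E =
  (2 / lambda ^+ 2 -
   (2 * t / lambda + 2 / lambda ^+ 2) * expR (- (lambda * t)))%:E.
Proof.
move=> l0 t0.
have cexp : continuous (fun r : R => 2 * r * expR (- (lambda * r)))%R.
  move=> x; apply: continuousM.
    by apply: continuousM => //; exact: cst_continuous.
  apply: continuous_comp; last exact: continuous_expR.
  apply: (@continuousN _ R^o); apply: continuousM => //; exact: cst_continuous.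
(* The antiderivative comes from one integration by parts. *)
pose F (r : R) : R :=
  (- ((2 / lambda * r + 2 / lambda ^+ 2) * expR (- (lambda * r))))%R.
have dF (x : R) : is_derive x 1%R F (2 * x * expR (- (lambda * x)))%R.
  by apply: is_derive_eq; rewrite /GRing.scale/=; field.
rewrite (integral_FTC2_is_derive t0 cexp dF) /F.
by rewrite !mulr0 oppr0 expR0; congr _%:E; ring.
Qed.

Lemma integral_mul2r (m : R) : (0 <= m)%R ->
  \int[mu]_(r in `[0%R, m]) (2 * r)%:E = (m ^+ 2)%:E.
Proof.
move=> m0.
have c2 : continuous (fun r : R => 2 * r)%R.
  exact: mulrl_continuous.
have dF (x : R) : is_derive x 1%R (fun r => r ^+ 2)%R (2 * x)%R.
  by apply: is_derive_eq; rewrite /GRing.scale/=; ring.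
by rewrite (integral_FTC2_is_derive m0 c2 dF) expr0n subr0.
Qed.

End integrals.

(** * Integration of tails *)

Section layer_cake.
Local Open Scope ereal_scope.
Context d (T : measurableType d) (R : realType) (P : probability T R).
Let mu : {measure set (measurableTypeR R) -> \bar R} := @lebesgue_measure R.

(** Tonelli's theorem on the region [0 <= r <= M w]; above [t] the event [r <= M w] is empty, so the
    outer integral stops at [t]. *)
Lemma layer_cake (M : T -> R) (g : R -> R) (t : R) :
  measurable_fun setT M -> (forall w, 0 <= M w <= t)%R ->
  measurable_fun setT g -> (forall r, 0 <= r -> 0 <= g r)%R ->
  \int[P]_w (\int[mu]_(r in `[0%R, M w]) (g r)%:E) =
  \int[mu]_(r in `[0%R, t]) ((g r)%:E * P [set w | (r <= M w)%R]).
Proof.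
move=> mM Mt mg g0.
pose f (p : T * measurableTypeR R) : \bar R :=
  (if (0 <= p.2)%R && (p.2 <= M p.1)%R then g p.2 else 0%R)%:E.
have mf : measurable_fun setT f.
  apply/measurable_EFinP; apply: measurable_fun_ifT => //=.
    apply: measurable_and; apply: measurable_fun_ler => //.
    exact: measurableT_comp.
  exact: measurableT_comp.
have f0 p : 0 <= f p.
  by rewrite /f lee_fin; case: ifP => // /andP[p0 _]; exact: g0.
transitivity (\int[P]_w \int[mu]_r f (w, r)).
  apply: eq_integral => w _; rewrite integral_mkcond.
  apply: eq_integral => r _; rewrite patchE /f/= mem_setE in_itv/=.
  by case: ifP.
rewrite (fubini_tonelli f mf f0) [RHS]integral_mkcond.
apply: eq_integral => r _; rewrite patchE mem_setE in_itv/= /f /=.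
have [r0|r0] /= := leP 0%R r; last by apply: integral0_eq.
have mr : measurable [set w | (r <= M w)%R] by exact: measurable_le_set.
case: ifPn => [rt|]; last first.
  rewrite -ltNge => tr; apply: integral0_eq => w _.
  case: ifPn => // rM; have := lt_le_trans tr rM.
  by rewrite ltNge; case/andP: (Mt w) => _ ->.
transitivity (\int[P]_w ((g r)%:E * (\1_[set w | (r <= M w)%R] w)%:E)).
  apply: eq_integral => w _; rewrite indicE.
  case: ifPn => rM; first by rewrite mem_set// mule1.
  by rewrite memNset ?mule0//; exact/negP.
rewrite ge0_integralZl//=.
- by rewrite integral_indic// setIT.
- by apply/measurable_EFinP; exact: measurable_indic.
- by rewrite lee_fin g0.
Qed.

End layer_cake.

(** * Moments of the truncated age and of the process *)

Section moments.
Context d (T : measurableType d) (R : realType) (P : probability T R).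
Variables (X : nat -> {RV P >-> R}) (lambda alpha : R).
Hypothesis lambda_gt0 : 0 < lambda.
Hypothesis alpha_ge0 : 0 <= alpha.
Hypothesis X_renewal : inter_renewal_times X.
Hypothesis X_exp : forall i, exponentially_distributed lambda (X i).
Variable t : R.
Hypothesis t_ge0 : 0 <= t.

Local Notation Z := (timing_process_started_at X alpha t).
Local Notation G := (good_event X).

(* Z itself need not be measurable off the good event. *)
Definition started_at_rv : T -> R := Z \_ G.

(** The tail formula covers only [[0, t]]; truncation keeps the part of the law that it
    determines. *)
Definition truncated_age (w : T) : R := Num.min (started_at_rv w) t.

(** On this event no renewal occurs from just after the hitting time until [t] later. *)
Definition late_event : set T := G `&` [set w | t <= Z w].

Local Notation Z' := started_at_rv.
Local Notation M := truncated_age.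
Local Notation H := late_event.

Lemma started_at_rvE w : G w -> Z' w = Z w.
Proof. by move=> Gw; rewrite /started_at_rv patchE mem_set. Qed.

Lemma started_at_rv0 w : ~ G w -> Z' w = 0.
Proof. by move=> Gw; rewrite /started_at_rv patchE memNset. Qed.

Lemma measurable_started_at_rv : measurable_fun setT Z'.
Proof.
apply/(measurable_restrictT _ (measurable_good_event X)).
exact: measurable_started_at.
Qed.

Lemma measurable_truncated_age : measurable_fun setT M.
Proof. by apply: measurable_minr => //; exact: measurable_started_at_rv. Qed.

Lemma started_at_rv_bounds w : 0 <= Z' w <= alpha + t.
Proof.
have [Gw|Gw] := pselect (G w); last by rewrite started_at_rv0// lexx addr_ge0.
by rewrite started_at_rvE//; exact: started_at_bounds.
Qed.

Lemma truncated_age_bounds w : 0 <= M w <= t.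
Proof.
rewrite /truncated_age le_min t_ge0 ge_min lexx orbT !andbT.
by case/andP: (started_at_rv_bounds w).
Qed.

Lemma measurable_late_event : measurable H.
Proof.
have mG := measurable_good_event X.
rewrite (_ : H = G `&` [set w | t <= Z' w]); last first.
  apply/seteqP; split=> w [Gw /=] tZ; split => //=; move: tZ;
  by rewrite started_at_rvE.
apply: measurableI => //; apply: measurable_le_set => //.
exact: measurable_started_at_rv.
Qed.

(** From [t] upwards the process takes only the value [alpha + t], which exceeds the truncated value
    by [alpha]; off the good event every term is 0. *)
Lemma started_at_rv_decomp w : Z' w = M w + alpha * \1_H w.
Proof.
rewrite /truncated_age; have [Gw|Gw] := pselect (G w); last first.
  rewrite started_at_rv0// indicE memNset; last by case.
  by rewrite mulr0 addr0 min_l.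
rewrite started_at_rvE//; have [tZ|Zt] := leP t (Z w).
  rewrite indicE mem_set//= mulr1 (started_at_ge alpha_ge0 t_ge0 Gw tZ).
  by rewrite addrC.
rewrite indicE memNset; last by case=> _ /=; rewrite leNgt Zt.
by rewrite mulr0 addr0.
Qed.

(** Turns the cross term of the square into a multiple of the indicator, the truncated age being [t]
    on the late event. *)
Lemma truncated_age_late w : \1_H w * M w = t * \1_H w :> R.
Proof.
rewrite indicE; have [|_] := boolP (w \in H); last by rewrite mulr0 mul0r.
rewrite inE => -[Gw /= tZ]; rewrite mul1r mulr1 /truncated_age started_at_rvE//.
by rewrite min_r.
Qed.

Lemma prob_truncated_age r : 0 <= r <= t ->
  P [set w | r <= M w] = (expR (- (lambda * r)))%:E.
Proof.
(* The case [r = 0] is apart: [M] vanishes off the good event, so [r <= M w] forces a good path only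
   for positive [r]. *)
move=> /andP[r0 rt]; move: r0; rewrite le_eqVlt => /predU1P[<-|r0].
  rewrite mulr0 oppr0 expR0 -(probability_setT P); congr (P _).
  by apply/seteqP; split => w //= _; case/andP: (truncated_age_bounds w).
have r_itv : 0 <= r <= t by rewrite ltW.
rewrite -(prob_started_at_ge lambda_gt0 alpha_ge0 X_renewal X_exp t_ge0 r_itv).
congr (P _); apply/seteqP; split => w /=.
  rewrite /truncated_age le_min rt andbT => rZ.
  have Gw : G w.
    by apply: contrapT => Gw; move: rZ; rewrite started_at_rv0// leNgt r0.
  by split => //; rewrite -started_at_rvE.
by move=> [Gw rZ]; rewrite /truncated_age le_min rt andbT started_at_rvE.
Qed.

Lemma prob_late_event : P H = (expR (- (lambda * t)))%:E.
Proof.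
by apply: (prob_started_at_ge (lambda := lambda)) => //; rewrite t_ge0 lexx.
Qed.

Lemma expectation_truncated_age :
  expectation P M = (lambda^-1 * (1 - expR (- (lambda * t))))%:E.
Proof.
rewrite -integral_expR ?gt_eqF// unlock.
transitivity (\int[P]_w (\int[lebesgue_measure]_(r in `[0%R, M w]) (1%R)%:E))%E.
  apply: eq_integral => w _; have /andP[M0 _] := truncated_age_bounds w.
  rewrite integral_cst//= mul1e lebesgue_measure_itv/= lte_fin.
  by case: ltP => [_|M0']; [rewrite oppr0 addr0|congr _%:E; apply/le_anti/andP].
rewrite (@layer_cake _ _ _ P M (fun=> 1) t)//.
- apply: eq_integral => r; rewrite inE/= in_itv/= => rt.
  by rewrite mul1e prob_truncated_age.
- exact: measurable_truncated_age.
- exact: truncated_age_bounds.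
Qed.

(** Layer cake with [g r = 2 * r], whose integral up to [M w] is [M w ^+ 2]. *)
Lemma expectation_truncated_age_sqr :
  expectation P (M ^+ 2) = (2 / lambda ^+ 2 -
    (2 * t / lambda + 2 / lambda ^+ 2) * expR (- (lambda * t)))%:E.
Proof.
rewrite -integral_mulr_expR ?gt_eqF// unlock.
transitivity
  (\int[P]_w (\int[lebesgue_measure]_(r in `[0%R, M w]) (2 * r)%R%:E))%E.
  apply: eq_integral => w _; have /andP[M0 _] := truncated_age_bounds w.
  by rewrite integral_mul2r.
rewrite (@layer_cake _ _ _ P M (fun r => 2 * r) t)//.
- apply: eq_integral => r; rewrite inE/= in_itv/= => rt.
  by rewrite prob_truncated_age.
- exact: measurable_truncated_age.
- exact: truncated_age_bounds.
- by apply: measurable_funM.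
- by move=> r r0; rewrite mulr_ge0.
Qed.

Lemma truncated_age_Lfun1 : M \in Lfun P 1%E.
Proof.
apply: (@bounded_Lfun1 _ _ _ P _ t); first exact: measurable_truncated_age.
by move=> w; have /andP[M0 Mt] := truncated_age_bounds w; rewrite ger0_norm.
Qed.

Lemma truncated_age_sqr_Lfun1 : (M ^+ 2) \in Lfun P 1%E.
Proof.
apply: (@bounded_Lfun1 _ _ _ P _ (t ^+ 2)).
  exact: (measurable_funX 2 measurable_truncated_age).
move=> w; have /andP[M0 Mt] := truncated_age_bounds w.
by rewrite [X in `|X|](_ : _ = M w ^+ 2)// ger0_norm ?sqr_ge0// lerXn2r.
Qed.

Lemma late_event_Lfun1 : (\1_H : T -> R) \in Lfun P 1%E.
Proof.
apply: (@bounded_Lfun1 _ _ _ P _ 1).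
  by apply: measurable_indic; exact: measurable_late_event.
by move=> w; rewrite ger0_norm ?ler_nat ?leq_b1.
Qed.

Lemma started_at_rv_funE : Z' = M \+ alpha \o* \1_H.
Proof. by apply/funext => w; rewrite started_at_rv_decomp /= mulrC. Qed.

Lemma started_at_rv_sqrE :
  Z' * Z' = M ^+ 2 \+ (2 * t * alpha + alpha ^+ 2) \o* \1_H.
Proof.
apply/funext => w; rewrite !fctE /= started_at_rv_decomp.
have i2 : \1_H w * \1_H w = \1_H w :> R.
  by rewrite indicE; case: (_ \in _); rewrite ?mulr1 ?mulr0.
transitivity (M w ^+ 2 + 2 * alpha * (\1_H w * M w) +
              alpha ^+ 2 * (\1_H w * \1_H w)).
  by ring.
by rewrite i2 truncated_age_late; ring.
Qed.

Lemma expectation_started_at_rv :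
  expectation P Z' = (lambda^-1 * (1 - expR (- (lambda * t))) +
              alpha * expR (- (lambda * t)))%:E.
Proof.
rewrite started_at_rv_funE expectationD; last 2 first.
- exact: truncated_age_Lfun1.
- by apply: Lfun_scale => //; exact: late_event_Lfun1.
rewrite expectationZl; last exact: late_event_Lfun1.
rewrite expectation_indic; last exact: measurable_late_event.
by rewrite prob_late_event expectation_truncated_age.
Qed.

Lemma expectation_started_at_rv_sqr :
  expectation P (Z' * Z') = (2 / lambda ^+ 2 -
    (2 * t / lambda + 2 / lambda ^+ 2) * expR (- (lambda * t)) +
    (2 * t * alpha + alpha ^+ 2) * expR (- (lambda * t)))%:E.
Proof.
rewrite started_at_rv_sqrE expectationD; last 2 first.
- exact: truncated_age_sqr_Lfun1.
- by apply: Lfun_scale => //; exact: late_event_Lfun1.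
rewrite expectationZl; last exact: late_event_Lfun1.
rewrite expectation_indic; last exact: measurable_late_event.
by rewrite prob_late_event expectation_truncated_age_sqr.
Qed.

Lemma expectation_started_at : expectation P Z = expectation P Z'.
Proof.
apply: (@expectation_eq_conull _ _ _ P G).
- exact: measurable_good_event.
- exact: (good_event_prob1 lambda_gt0).
- by move=> w; exact: timing_process_ge0.
- by move=> w; case/andP: (started_at_rv_bounds w).
- by move=> w /set_mem Gw; rewrite started_at_rvE.
Qed.

(** The two means coincide, so the squared deviations are nonnegative functions that agree on the
    good event. *)
Lemma variance_started_at : variance P Z = variance P Z'.
Proof.
rewrite /variance unlock -expectation_started_at.
apply: (@expectation_eq_conull _ _ _ P G).
- exact: measurable_good_event.
- exact: (good_event_prob1 lambda_gt0).
- by move=> w; exact: sqr_ge0.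
- by move=> w; exact: sqr_ge0.
- by move=> w /set_mem Gw; rewrite !fctE/= started_at_rvE.
Qed.

Lemma variance_started_at_rv :
  variance P Z' = (expectation P (Z' * Z')%R - expectation P Z' ^+ 2)%E.
Proof.
have Z1 : Z' \in Lfun P 1%E.
  rewrite started_at_rv_funE rpredD//; first exact: truncated_age_Lfun1.
  by apply: Lfun_scale => //; exact: late_event_Lfun1.
rewrite /variance covarianceE// started_at_rv_sqrE rpredD//.
  exact: truncated_age_sqr_Lfun1.
by apply: Lfun_scale => //; exact: late_event_Lfun1.
Qed.

End moments.
Theorem corollary18 (d : measure_display) (T : measurableType d)
    (R : realType) (P : probability T R)
    (X : nat -> {RV P >-> R}) (lambda alpha : R)
    (lambda_gt0 : 0 < lambda) (alpha_ge0 : 0 <= alpha)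
    (X_renewal : inter_renewal_times X)
    (X_exp : forall i, exponentially_distributed lambda (X i)) :
  forall t : R, 0 <= t ->
    expectation P (timing_process_started_at X alpha t) =
      (lambda^-1 * (1 - expR (- (lambda * t))) +
       alpha * expR (- (lambda * t)))%:E
    /\
    variance P (timing_process_started_at X alpha t) =
      ((lambda ^+ 2)^-1 *
       (1
        + expR (- (t * lambda)) *
          (alpha ^+ 2 * lambda ^+ 2 + 2 * t * alpha * lambda ^+ 2
           - 2 * alpha * lambda - 2 * t * lambda)
        + expR (- (2 * t * lambda)) *
          (2 * alpha * lambda - 1 - alpha ^+ 2 * lambda ^+ 2)))%:E.
Proof.
move=> t t_ge0.
rewrite (expectation_started_at lambda_gt0)//.
rewrite (variance_started_at lambda_gt0)// variance_started_at_rv//.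
rewrite (expectation_started_at_rv_sqr lambda_gt0)//.
rewrite (expectation_started_at_rv lambda_gt0)//; split => //.
rewrite -EFin_expe -EFinB; congr _%:E.
(* The square of the mean produces this squared exponential; with a single exponential left, the
   claim is a rational identity. *)
have -> : expR (- (2 * t * lambda)) = expR (- (lambda * t)) ^+ 2.
  by rewrite -expRM_natl; congr expR; ring.
rewrite (mulrC t lambda); field.
by rewrite gt_eqF.
Qed.
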